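(* Let $M$ be a delta-matroid over a finite ground set $V$, and let $X\subseteq V$. If $M[X]$ is proper, then $d_{M[X]}(Y)=d_M(Y)$ for all $Y\subseteq X$.
   Context: A set system is a pair $M=(V,D)$ with $V$ a finite set (the ground set) and $D$ a family of subsets of $V$; it is proper if $D\neq\varnothing$. We write $Y\in M$ for $Y\in D$. $\triangle$ denotes symmetric difference. A delta-matroid is a proper set system $M$ satisfying the symmetric exchange axiom: for all $X,Y\in M$ and all $u\in X\triangle Y$, either $X\triangle\{u\}\in M$ or there is a $v\in X\triangle Y$ with $v\neq u$ such that $X\triangle\{u,v\}\in M$. For $X\subseteq V$, $M[X]=(X,\{Y\in D\mid Y\subseteq X\})$. For a proper set system $M$ with ground set $V$ and $Y\subseteq V$, $d_M(Y)=\min\{|Y\triangle Z| \mid Z\in M\}$. *)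

(* Defs.v *)
From mathcomp Require Import all_boot.

Set Implicit Arguments.
Unset Strict Implicit.
Unset Printing Implicit Defensive.

(* The ground set is a subset of an ambient finite type, so that M and its
   restrictions M[X], whose ground sets differ, have the same type. *)
Record set_system (T : finType) := SetSystem {
  ground : {set T};
  feasible : {set {set T}};
  feasible_sub : feasible \subset powerset ground
}.

Definition symdiff (T : finType) (A B : {set T}) : {set T} :=
  (A :\: B) :|: (B :\: A).

Definition proper_system (T : finType) (M : set_system T) : Prop :=
  feasible M != set0.

Definition symmetric_exchange (T : finType) (M : set_system T) : Prop :=
  forall X Y : {set T}, X \in feasible M -> Y \in feasible M ->
  forall u : T, u \in symdiff X Y ->
    symdiff X [set u] \in feasible M \/
    exists v : T, [/\ v \in symdiff X Y, v != u &
                      symdiff X [set u; v] \in feasible M].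

Definition delta_matroid (T : finType) (M : set_system T) : Prop :=
  proper_system M /\ symmetric_exchange M.

Lemma restrict_sub (T : finType) (M : set_system T) (X : {set T}) :
  [set Y in feasible M | Y \subset X] \subset powerset X.
Proof. by apply/subsetP=> Y; rewrite !inE => /andP[]. Qed.

(* M[X]; only meaningful when X \subset ground M. *)
Definition restrict (T : finType) (M : set_system T) (X : {set T}) :
  set_system T := SetSystem (restrict_sub M X).

(* d_M(Y). The neutral value #|ground M| bounds #|symdiff Y Z| for all
   Y, Z \subset ground M, so it does not affect the minimum when M is proper:
   see dist_attained and dist_le. *)
Definition dist (T : finType) (M : set_system T) (Y : {set T}) : nat :=
  \big[minn/#|ground M|]_(Z in feasible M) #|symdiff Y Z|.

Lemma dist_le (T : finType) (M : set_system T) (Y Z : {set T}) :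
  Z \in feasible M -> dist M Y <= #|symdiff Y Z|.
Proof.
move=> MZ; rewrite /dist; have := mem_index_enum Z.
elim: (index_enum _) => // W s IHs; rewrite inE big_cons.
case/predU1P=> [<-|/IHs le_s]; first by rewrite MZ geq_minl.
by case: ifP => // _; rewrite geq_min le_s orbT.
Qed.

Lemma dist_attained (T : finType) (M : set_system T) (Y : {set T}) :
  proper_system M -> Y \subset ground M ->
  exists2 Z, Z \in feasible M & dist M Y = #|symdiff Y Z|.
Proof.
move=> /set0Pn[Z0 MZ0] sYV.
have sZ0V : Z0 \subset ground M.
  by have := subsetP (feasible_sub M) _ MZ0; rewrite inE.
have bnd : #|symdiff Y Z0| <= #|ground M|.
  apply/subset_leq_card; rewrite subUset.
  by rewrite !(subset_trans (subsetDl _ _)).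
have dle := dist_le Y MZ0.
have [eqd|[Z MZ ->]] : dist M Y = #|ground M| \/
    exists2 Z, Z \in feasible M & dist M Y = #|symdiff Y Z|.
- rewrite /dist; elim/big_ind: _ => [|x y Hx Hy|Z MZ]; first by left.
    by case: (leqP x y) => _.
  by right; exists Z.
- by exists Z0 => //; apply/eqP; rewrite eqn_leq dle eqd bnd.
by exists Z.
Qed.

(* Main.v *)
(** Starting from a feasible set nearest to [Y], exchange against a feasible
    subset of [X]: an element [u] outside [X] is removed, which brings the set
    closer to [Y] by one, and the partner [v] costs at most one.  As the target
    lies inside [X], no element outside [X] ever comes in. *)

Require Import Defs.
From mathcomp Require Import all_boot.

Set Implicit Arguments.
Unset Strict Implicit.
Unset Printing Implicit Defensive.

(* Both outcomes of the exchange axiom at once: [v = u] is the first one. *)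
Lemma symmetric_exchange_pair (T : finType) (M : set_system T) (X Y : {set T})
    (u : T) :
  symmetric_exchange M -> X \in feasible M -> Y \in feasible M ->
  u \in symdiff X Y ->
  exists2 v, v \in symdiff X Y & symdiff X [set u; v] \in feasible M.
Proof.
move=> exM MX MY XYu; have [MXu | [v [XYv _ MXuv]]] := exM _ _ MX MY u XYu.
  by exists u => //; rewrite setUid.
by exists v.
Qed.

(** Each exchange strictly shrinks [Z :\: X] without moving away from [Y], so induction on its size
    ends inside [X]. *)
Lemma feasible_push_into (T : finType) (M : set_system T) (X Y W Z : {set T}) :
  symmetric_exchange M -> Y \subset X ->
  W \in feasible M -> W \subset X -> Z \in feasible M ->
  exists Z', [/\ Z' \in feasible M, Z' \subset X &
                 #|symdiff Y Z'| <= #|symdiff Y Z|].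
Proof.
move=> exM sYX MW sWX; have [n] := ubnP #|Z :\: X|.
elim: n Z => // n IHn Z; rewrite ltnS => leZn MZ.
have [sZX | /subsetPn[u Zu Xu]] := boolP (Z \subset X); first by exists Z.
have Wu : u \notin W by apply: contra Xu; apply: (subsetP sWX).
have Yu : u \notin Y by apply: contra Xu; apply: (subsetP sYX).
have ZWu : u \in symdiff Z W by rewrite !inE Zu Wu.
have [v ZWv] := symmetric_exchange_pair exM MZ MW ZWu.
set Z1 := symdiff Z [set u; v] => MZ1.
(* The partner [v] may also lie outside [X]; as [W] has no element there, [v] is then in [Z] and
   gets removed too. *)
have Z1XD : Z1 :\: X \proper Z :\: X.
  apply/properP; split; last first.
    by exists u; rewrite !inE ?eqxx ?Zu ?Xu.
  apply/subsetP=> x; rewrite !inE => /andP[Xx]; rewrite Xx /=.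
  have Wx : x \notin W by apply: contra Xx; apply: (subsetP sWX).
  case/orP=> [/andP[] // | /andP[Zx /orP[/eqP xu | /eqP xv]]].
    by rewrite xu.
  by move: ZWv; rewrite -xv !inE (negPf Wx) (negPf Zx).
have leZ1 : #|symdiff Y Z1| <= #|symdiff Y Z|.
  have YZu : u \in symdiff Y Z by rewrite !inE Zu Yu orbT.
  (* Dropping [u] frees one unit, which pays for a possible new difference at [v]. *)
  rewrite (cardsD1 u (symdiff Y Z)) YZu.
  apply: leq_trans (_ : #|v |: symdiff Y Z :\ u| <= _); last first.
    by rewrite cardsU1 leq_add2r leq_b1.
  apply/subset_leq_card/subsetP=> x; rewrite !inE.
  have [-> | _] := eqVneq x u; first by rewrite Zu (negPf Yu).
  by case: (x == v); case: (x \in Y); case: (x \in Z).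
have [|Z' [MZ' sZ'X leZ']] := IHn Z1 _ MZ1.
  exact: leq_trans (proper_card Z1XD) leZn.
by exists Z'; split=> //; apply: leq_trans leZ' leZ1.
Qed.

Theorem theorem5p2 (T : finType) (M : set_system T) (X : {set T}) :
  delta_matroid M -> X \subset ground M -> proper_system (restrict M X) ->
  forall Y : {set T}, Y \subset X -> dist (restrict M X) Y = dist M Y.
Proof.
move=> [prM exM] sXV prMX Y sYX; apply/eqP; rewrite eqn_leq; apply/andP; split.
  have [Z MZ ->] := dist_attained prM (subset_trans sYX sXV).
  have /set0Pn[W] := prMX; rewrite inE => /andP[MW sWX].
  have [Z' [MZ' sZ'X leZ']] := feasible_push_into exM sYX MW sWX MZ.
  by apply: leq_trans leZ'; apply: dist_le; rewrite inE MZ'.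
(* Conversely, a nearest feasible set of [restrict M X] is feasible in [M], so it bounds
   [dist M Y]. *)
have [Z] := dist_attained prMX sYX.
by rewrite inE => /andP[MZ _] ->; apply: dist_le.
Qed.
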